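(* Let $\Omega\subset\mathbb{R}^n$ be a proper convex domain with Funk metric $F_\Omega$ and let $p\in\Omega$. For $x,y\in\mathbb{R}^n$ set $$\Phi_p(x,y)=\lim_{t\searrow0}\frac{F_\Omega(p+tx,\,p+ty)}{t}.$$ Then $\Phi_p$ (is well defined and) is a Minkowski weak metric on $\mathbb{R}^n$, and its unit ball is the translated domain $\Omega_p=\Omega-p$.
   Context: A proper convex domain in $\mathbb{R}^n$ is a non-empty open convex subset $\Omega\neq\mathbb{R}^n$. For $x\ne y$ in $\Omega$ let $R(x,y)=\{x+t(y-x): t\ge 0\}$. The Funk metric is $F_\Omega(x,x)=0$ and, for $x\ne y$, $F_\Omega(x,y)=\log\frac{|x-a|}{|y-a|}$ where $a$ is the unique point of $R(x,y)\cap\partial\Omega$ if $R(x,y)\not\subset\Omega$, and $F_\Omega(x,y)=0$ if $R(x,y)\subset\Omega$. A Minkowski weak metric on $\mathbb{R}^n$ is a function of the form $\delta(x,y)=\mathfrak p(y-x)$, where $\mathfrak p:\mathbb{R}^n\to[0,\infty)$ is a weak Minkowski norm, i.e. $\mathfrak p(\lambda v)=\lambda\mathfrak p(v)$ for $\lambda\ge0$ and $\mathfrak p(v+w)\le\mathfrak p(v)+\mathfrak p(w)$ (symmetry and positivity on non-zero vectors are not required). Its (open) unit ball is $\{y\in\mathbb{R}^n:\delta(0,y)<1\}$. *)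

(* Defs.v *)
From HB Require Import structures.
From mathcomp Require Import all_boot all_order all_algebra.
From mathcomp Require Import all_classical all_reals all_analysis.
Set Implicit Arguments.
Unset Strict Implicit.
Unset Printing Implicit Defensive.
Import Order.TTheory GRing.Theory Num.Theory.
Import numFieldNormedType.Exports.
Local Open Scope classical_set_scope.
Local Open Scope ring_scope.

(* The norm that the library puts on ['rV[R]_n] is the
   sup norm; it induces the usual topology, but [|x - a|] in the Funk metric is
   the Euclidean length, hence [enorm]. *)
Definition enorm (R : realType) (n : nat) (v : 'rV[R]_n) : R :=
  Num.sqrt (\sum_(i < n) v 0 i ^+ 2).

Definition proper_convex_domain (R : realType) (n : nat)
    (Omega : set 'rV[R]_n) : Prop :=
  [/\ Omega !=set0, open Omega, convex_set Omega & Omega <> setT].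

Definition boundary (T : topologicalType) (A : set T) : set T :=
  closure A `\` interior A.

Definition ray (R : realType) (n : nat) (x y : 'rV[R]_n) : set 'rV[R]_n :=
  [set x + t *: (y - x) | t in [set t : R | 0 <= t]].

(* For distinct [x], [y] in a proper convex domain [Omega] not containing the
   ray, the set below is a singleton and [get] returns its element. In all other
   cases the value is irrelevant. *)
Definition funk_exit (R : realType) (n : nat) (Omega : set 'rV[R]_n)
    (x y : 'rV[R]_n) : 'rV[R]_n :=
  get (ray x y `&` boundary Omega).

Definition funk (R : realType) (n : nat) (Omega : set 'rV[R]_n)
    (x y : 'rV[R]_n) : R :=
  if (x == y) || `[< ray x y `<=` Omega >] then 0
  else let a := funk_exit Omega x y in ln (enorm (x - a) / enorm (y - a)).

Definition weak_minkowski_norm (R : realType) (n : nat)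
    (N : 'rV[R]_n -> R) : Prop :=
  [/\ forall v, 0 <= N v,
      forall (l : R) v, 0 <= l -> N (l *: v) = l * N v
    & forall v w, N (v + w) <= N v + N w].

Definition minkowski_weak_metric (R : realType) (n : nat)
    (delta : 'rV[R]_n -> 'rV[R]_n -> R) : Prop :=
  exists2 N : 'rV[R]_n -> R,
    weak_minkowski_norm N & forall x y, delta x y = N (y - x).

Definition unit_ball (R : realType) (n : nat)
    (delta : 'rV[R]_n -> 'rV[R]_n -> R) : set 'rV[R]_n :=
  [set y | delta 0 y < 1].

Definition funk_quotient (R : realType) (n : nat) (Omega : set 'rV[R]_n)
    (p x y : 'rV[R]_n) (t : R) : R :=
  funk Omega (p + t *: x) (p + t *: y) / t.

Definition Phi (R : realType) (n : nat) (Omega : set 'rV[R]_n)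
    (p x y : 'rV[R]_n) : R :=
  lim (funk_quotient Omega p x y t @[t --> 0^'+]).

(* Main.v *)
Require Import Defs.
From HB Require Import structures.
From mathcomp Require Import all_boot all_order all_algebra.
From mathcomp Require Import all_classical all_reals all_analysis.
From mathcomp Require Import ring lra.
Set Implicit Arguments.
Unset Strict Implicit.
Unset Printing Implicit Defensive.
Import Order.TTheory GRing.Theory Num.Theory.
Import numFieldNormedType.Exports.
Local Open Scope classical_set_scope.
Local Open Scope ring_scope.

(** The limit is the gauge (Minkowski functional) of [Omega] relative to the
base point [p], that is [gauge Omega p v = inf {r > 0 | p + v / r in Omega}]:
one has [Phi Omega p x y = gauge Omega p (y - x)].

For [A] open and convex and [q] in [A], one has [gauge A q v < r] if and only if
[q + v / r] lies in [A] ([gauge_lt]), and everything about the gauge follows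
from this. It is a weak Minkowski norm, its open unit ball is [A - q], and the
boundary of [A] is the set of the [a] with [gauge A q (a - q) = 1]
([boundary_gauge]). A ray from [q] with direction [v = q' - q] therefore stays
in [A] exactly when [gauge A q v = 0], and otherwise leaves it at the single
point [q + v / gauge A q v]. This gives a formula valid in all cases
([funk_gauge]):
[funk A q q' = - ln (1 - gauge A q (q' - q))].

For [q = p + t *: x] and [q' = p + t *: y] the difference is [t *: (y - x)], so
the quotient of the theorem is [- ln (1 - t * f t) / t], where
[f t = gauge Omega (p + t *: x) (y - x)]. Subadditivity and homogeneity of the
gauge at [p] bound [f t] between [gauge Omega p (y - x)] divided by
[1 + t * gauge Omega p (- x)] and by [1 - t * gauge Omega p x]
([gauge_shift_ge], [gauge_shift_le]); hence [f t] tends to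
[gauge Omega p (y - x)] ([cvg_gauge_base]), and so does the quotient
([cvg_ln_slope]). *)

(** * The gauge of an open convex set *)

Lemma ge0_le_of_lt {R : realFieldType} {x y : R} :
  0 <= y -> (forall r, 0 < r -> y < r -> x <= r) -> x <= y.
Proof.
move=> y0 h; rewrite leNgt; apply/negP => yx.
by have := h ((x + y) / 2) ltac:(lra) ltac:(lra); lra.
Qed.

(** Convexity read off from a base point [q], for displacements from [q]. *)
Lemma convex_set_displacement {R : realType} {V : normedModType R} {A : set V}
    {q u w : V} {a b : R} :
  convex_set A -> A (q + u) -> A (q + w) -> 0 <= a -> 0 <= b -> a + b = 1 ->
  A (q + (a *: u + b *: w)).
Proof.
move=> cA Au Aw a0 b0 ab; have a1 : a <= 1 by lra.
have : A (a *: (q + u) + (1 - a) *: (q + w)).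
  by rewrite -inE; exact: (cA _ _ (Itv01 a0 a1) (mem_set Au) (mem_set Aw)).
have -> : 1 - a = b by lra.
by rewrite !scalerDr addrACA -scalerDl ab scale1r.
Qed.

Lemma open_displacement {R : realType} {V : normedModType R} {A : set V}
    {q : V} :
  open A -> A q -> exists2 e : R, 0 < e & forall z, `|z| < e -> A (q + z).
Proof.
move=> oA Aq; have /nbhs_ballP[e /= e0 He] := open_nbhs_nbhs (conj oA Aq).
exists e => // z ze; apply: He; rewrite -ball_normE /=.
by rewrite opprD addrA subrr add0r normrN.
Qed.

(** The gauge (Minkowski functional) of [A] relative to the base point [q]. The
    infimum is meaningful when the set is non-empty, which holds for all [v] when
    [A] is a neighbourhood of [q]; it is 0 by default for the empty set. *)
Definition gauge {R : realType} {V : normedModType R} (A : set V) (q v : V) : R :=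
  inf [set r : R | 0 < r /\ A (q + r^-1 *: v)].

Section Gauge.
Context {R : realType} {V : normedModType R} {A : set V}.
Context (oA : open A) (cA : convex_set A).

Section BasePoint.
Context {q : V} (Aq : A q).
Implicit Types (u v w : V) (r : R).

Lemma gauge_ge0 v : 0 <= gauge A q v.
Proof.
have [|/set0P/negP] := pselect ([set r : R | 0 < r /\ A (q + r^-1 *: v)] !=set0).
  by move/lb_le_inf; apply => r [/ltW].
by rewrite negbK => /eqP E; rewrite /gauge E inf0.
Qed.

(** Since [A] is open, the infimum is not attained; this is why membership in
    [A] is equivalent to a strict inequality. *)
Lemma gauge_lt v r : 0 < r -> (gauge A q v < r) <-> A (q + r^-1 *: v).
Proof.
move=> r0; have [e e0 He] := open_displacement oA Aq; split.
  move/inf_lt => [|s [s0 As] sr].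
    (* the set defining the gauge is non-empty *)
    exists ((`|v| + 1) / e); have v0 := normr_ge0 v; split.
      by rewrite divr_gt0 //; lra.
    apply: He; rewrite normrZ normfV gtr0_norm; last by rewrite divr_gt0 //; lra.
    rewrite invf_div mulrAC -mulrA gtr_pMr // ltr_pdivrMr; lra.
  have := @convex_set_displacement _ _ _ _ _ 0 (s / r) (1 - s / r) cA As.
  rewrite addr0 scaler0 addr0 scalerA mulrAC divff ?gt_eqF // mul1r; apply => //.
  - by rewrite divr_ge0 ?ltW.
  - by rewrite subr_ge0 ler_pdivrMr // mul1r ltW.
  - ring.
move=> Ar; have [d d0 Hd] := open_displacement oA Ar.
have v0 := normr_ge0 v.
(* c * |v| < d; the + 1 covers the case v = 0 *)
pose c := d / (`|v| + 1); have c0 : 0 < c by rewrite divr_gt0 //; lra.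
have rV : 0 < r^-1 by rewrite invr_gt0.
(* enlarging the coefficient 1 / r of v by c keeps the point inside A *)
apply: (@le_lt_trans _ _ (r^-1 + c)^-1).
  apply: ge_inf; first by exists 0 => s [/ltW].
  split; first by rewrite invr_gt0; lra.
  rewrite invrK scalerDl addrA; apply: Hd.
  rewrite normrZ gtr0_norm // /c mulrAC -mulrA gtr_pMr // ltr_pdivrMr; lra.
by rewrite invf_plt ?posrE //; lra.
Qed.

Lemma gauge_lt1 v : (gauge A q v < 1) <-> A (q + v).
Proof. by have := @gauge_lt v 1 ltr01; rewrite invr1 scale1r. Qed.

Lemma gauge0 : gauge A q 0 = 0.
Proof.
apply/le_anti; rewrite gauge_ge0 andbT.
apply: ge0_le_of_lt => // r r0 _.
by apply/ltW/gauge_lt => //; rewrite scaler0 addr0.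
Qed.

Lemma gaugeZ (l : R) v : 0 <= l -> gauge A q (l *: v) = l * gauge A q v.
Proof.
rewrite le_eqVlt => /predU1P[<-|l0]; first by rewrite scale0r mul0r gauge0.
have key r : 0 < r -> (gauge A q (l *: v) < r) <-> (l * gauge A q v < r).
  move=> r0; rewrite mulrC -ltr_pdivlMr // !gauge_lt ?divr_gt0 //.
  by rewrite invf_div scalerA mulrC.
apply/le_anti/andP; split; apply: ge0_le_of_lt.
- by rewrite mulr_ge0 ?gauge_ge0 // ltW.
- by move=> r r0 /(key r r0)/ltW.
- exact: gauge_ge0.
- by move=> r r0 /(key r r0)/ltW.
Qed.

Lemma gaugeD v w : gauge A q (v + w) <= gauge A q v + gauge A q w.
Proof.
apply/ler_addgt0Pr => e e0.
have v0 := gauge_ge0 v; have w0 := gauge_ge0 w.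
pose a := gauge A q v + e / 2; pose b := gauge A q w + e / 2.
have a0 : 0 < a by rewrite /a; lra.
have b0 : 0 < b by rewrite /b; lra.
have -> : gauge A q v + gauge A q w + e = a + b by rewrite /a /b; field.
have ab0 : 0 < a + b by lra.
apply/ltW/gauge_lt => //.
have /gauge_lt Av : gauge A q v < a by rewrite /a; lra.
have /gauge_lt Aw : gauge A q w < b by rewrite /b; lra.
have := @convex_set_displacement _ _ _ _ _ _ (a / (a + b)) (b / (a + b)) cA
  (Av a0) (Aw b0).
rewrite !scalerA mulrAC divff ?gt_eqF // mulrAC divff ?gt_eqF // !mul1r -scalerDr.
apply; rewrite ?divr_ge0 ?ltW // -mulrDl divff ?gt_eqF //.
Qed.

(** The points where the gauge is 1 are outside [A], but their contractions
    towards [q] are inside; conversely a point of the closure of [A] enters [A]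
    under any contraction towards [q]. *)
Lemma boundary_gauge : boundary A = [set a | gauge A q (a - q) = 1].
Proof.
have [e e0 He] := open_displacement oA Aq.
apply/seteqP; split => a /=.
  move=> [cla]; rewrite (interior_id _).1 // => nAa.
  apply/le_anti/andP; split; last first.
    rewrite leNgt; apply/negP => /gauge_lt1.
    by rewrite addrC subrK.
  apply: ge0_le_of_lt => // r r0 r1; apply/ltW/gauge_lt => //.
  have r10 : 0 < r - 1 by lra.
  have [b [Ab]] := cla _ (nbhsx_ballx a (e * (r - 1)) (mulr_gt0 e0 r10)).
  rewrite -ball_normE /= => abe.
  (* q + (a - q) / r is a convex combination, with weights 1 / r and 1 - 1 / r,
     of b and of the point q + (a - b) / (r - 1), which is close to q *)
  have Aqb : A (q + (b - q)) by rewrite addrC subrK.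
  have /He Aqw : `|(r - 1)^-1 *: (a - b)| < e.
    by rewrite normrZ normfV gtr0_norm // mulrC ltr_pdivrMr.
  have := @convex_set_displacement _ _ _ _ _ _ r^-1 (1 - r^-1) cA Aqb Aqw.
  rewrite scalerA.
  have -> : (1 - r^-1) * (r - 1)^-1 = r^-1.
    by field; rewrite !gt_eqF.
  have -> : r^-1 *: (b - q) + r^-1 *: (a - b) = r^-1 *: (a - q).
    by rewrite -scalerDr addrC addrA subrK.
  apply.
  - by rewrite invr_ge0 ltW.
  - by rewrite subr_ge0 invf_le1 // ltW.
  - ring.
move=> g1; split; last first.
  move/interior_subset => Aa; suff : gauge A q (a - q) < 1 by rewrite g1 ltxx.
  by apply/gauge_lt1; rewrite addrC subrK.
move=> B /nbhs_ballP[d /= d0 dB].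
have n0 := normr_ge0 (a - q).
(* the contraction 1 - c towards q moves a by less than d *)
pose c := d / (d + `|a - q| + 1).
have c0 : 0 < c by rewrite divr_gt0 //; lra.
have c1 : c < 1 by rewrite ltr_pdivrMr; lra.
exists (q + (1 - c) *: (a - q)); split.
  by apply/gauge_lt1; rewrite gaugeZ ?g1; lra.
apply: dB; rewrite -ball_normE /= scalerBl scale1r addrA [q + _]addrC subrK.
rewrite opprB addrC subrK normrZ gtr0_norm // /c.
rewrite mulrAC -mulrA gtr_pMr // ltr_pdivrMr; lra.
Qed.

End BasePoint.

(** This estimate and [gauge_shift_ge] compare the gauges relative to two base points;
    together they give the continuity of the gauge in its base point along a
    segment. *)
Lemma gauge_shift_le p x v : A p -> A (p + x) ->
  (1 - gauge A p x) * gauge A (p + x) v <= gauge A p v.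
Proof.
move=> Ap Ax; have x1 := (gauge_lt1 Ap x).2 Ax.
have d0 : 0 < 1 - gauge A p x by lra.
rewrite mulrC -ler_pdivlMr //; apply: ge0_le_of_lt.
  by rewrite divr_ge0 ?gauge_ge0 // ltW.
move=> r r0; rewrite ltr_pdivrMr // => vr; apply/ltW/gauge_lt => //.
rewrite -addrA; apply/gauge_lt1 => //; apply: le_lt_trans (gaugeD Ap _ _) _.
rewrite gaugeZ // ?invr_ge0 ?(ltW r0) // -ltrBrDl mulrC ltr_pdivrMr //; lra.
Qed.

Lemma gauge_shift_ge p x v : A p -> A (p + x) ->
  gauge A p v <= (1 + gauge A p (- x)) * gauge A (p + x) v.
Proof.
move=> Ap Ax; have n0 := @gauge_ge0 p (- x).
rewrite mulrC -ler_pdivrMr; last by lra.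
apply: ge0_le_of_lt => [|r r0 /gauge_lt]; first exact: gauge_ge0.
move=> /(_ Ax r0); rewrite -addrA => /(gauge_lt1 Ap) lt1.
rewrite ler_pdivrMr; last by lra.
rewrite mulrC -ler_pdivrMr // mulrC -gaugeZ ?invr_ge0 ?(ltW r0) //.
have -> : r^-1 *: v = x + r^-1 *: v + - x by rewrite addrAC subrr add0r.
by apply: le_trans (gaugeD Ap _ _) _; lra.
Qed.

End Gauge.

(** * The Funk metric in terms of the gauge *)

Lemma enormZ (R : realType) (n : nat) (c : R) (v : 'rV[R]_n) :
  enorm (c *: v) = `|c| * enorm v.
Proof.
rewrite /enorm -sqrtr_sqr -sqrtrM ?sqr_ge0 //; congr Num.sqrt.
by rewrite mulr_sumr; apply: eq_bigr => i _; rewrite mxE exprMn.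
Qed.

Lemma enorm_gt0 (R : realType) (n : nat) (v : 'rV[R]_n) :
  v != 0 -> 0 < enorm v.
Proof.
move=> v0; rewrite /enorm sqrtr_gt0 lt_neqAle sumr_ge0 => [|i _]; last first.
  exact: sqr_ge0.
rewrite andbT eq_sym; apply: contra_neqN v0 => /eqP S0.
apply/rowP => i; rewrite mxE; apply/eqP; rewrite -sqrf_eq0; apply/eqP.
by apply: (psumr_eq0P _ S0) => // j _; exact: sqr_ge0.
Qed.

Section Funk.
Context {R : realType} {n : nat} {Omega : set 'rV[R]_n}.
Context (oO : open Omega) (cO : convex_set Omega).

Lemma ray_subset_gauge (q q' : 'rV[R]_n) : Omega q ->
  ray q q' `<=` Omega <-> gauge Omega q (q' - q) = 0.
Proof.
move=> Oq; split=> [sub|g0 _ [t /= t0 <-]].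
  apply/le_anti; rewrite gauge_ge0 // andbT.
  apply: ge0_le_of_lt => // r r0 _; apply/ltW/gauge_lt => //.
  by apply: sub; exists r^-1 => //=; rewrite invr_ge0 ltW.
by apply/(gauge_lt1 oO cO Oq); rewrite gaugeZ // g0 mulr0.
Qed.

(** The ray leaves [Omega] where the gauge of the displacement reaches 1. *)
Lemma funk_exit_gauge (q q' : 'rV[R]_n) : Omega q ->
  gauge Omega q (q' - q) != 0 ->
  funk_exit Omega q q' = q + (gauge Omega q (q' - q))^-1 *: (q' - q).
Proof.
move=> Oq g0; rewrite /funk_exit (boundary_gauge oO cO Oq).
apply: get_subset1.
  have gi : 0 <= (gauge Omega q (q' - q))^-1 by rewrite invr_ge0 gauge_ge0.
  split; first by exists (gauge Omega q (q' - q))^-1.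
  by rewrite /= addrC addKr gaugeZ // mulVf.
have key a : (ray q q' `&` [set a | gauge Omega q (a - q) = 1]) a ->
    a = q + (gauge Omega q (q' - q))^-1 *: (q' - q).
  case=> -[t /= t0 <-]; rewrite addrC addKr gaugeZ // => tg.
  by rewrite -[t](mulfK g0) tg mul1r addrC.
by move=> a b /key -> /key ->.
Qed.

Lemma funk_gauge (q q' : 'rV[R]_n) : Omega q -> Omega q' ->
  funk Omega q q' = - ln (1 - gauge Omega q (q' - q)).
Proof.
move=> Oq Oq'; rewrite /funk; have [<-|qq'] /= := eqVneq q q'.
  by rewrite subrr gauge0 // subr0 ln1 oppr0.
case: asboolP => [/ray_subset_gauge -> //|nsub].
  by rewrite subr0 ln1 oppr0.
have g0 : gauge Omega q (q' - q) != 0.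
  by apply/eqP => /(ray_subset_gauge q' Oq).
have g1 : gauge Omega q (q' - q) < 1.
  by apply/gauge_lt1 => //; rewrite addrC subrK.
have gp : 0 < gauge Omega q (q' - q) by rewrite lt_neqAle eq_sym g0 gauge_ge0.
rewrite funk_exit_gauge //; set g := gauge Omega q (q' - q) in g0 g1 gp *.
have -> : q - (q + g^-1 *: (q' - q)) = - g^-1 *: (q' - q).
  by rewrite opprD addrA subrr add0r scaleNr.
have -> : q' - (q + g^-1 *: (q' - q)) = (1 - g^-1) *: (q' - q).
  by rewrite opprD addrA scalerBl scale1r.
have w0 : 0 < enorm (q' - q) by rewrite enorm_gt0 // subr_eq0 eq_sym.
have gi : 1 < g^-1 by rewrite invf_gt1.
rewrite !enormZ normrN gtr0_norm ?invr_gt0 // ltr0_norm; last by lra.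
rewrite -lnV; last by rewrite posrE; lra.
clearbody g; congr ln; field.
by rewrite g0 (gt_eqF w0) subr_eq0 (gt_eqF g1) subr_eq0 (lt_eqF g1).
Qed.

(** * The infinitesimal limit *)

Lemma near0_displacement (p x : 'rV[R]_n) : Omega p ->
  \forall t \near (0 : R)^'+, Omega (p + t *: x).
Proof.
move=> Op; have x0 := gauge_ge0 x : 0 <= gauge Omega p x.
near=> t.
have t0 : 0 < t by near: t; exact: nbhs_right_gt.
apply/(gauge_lt1 oO cO Op); rewrite gaugeZ ?ltW //.
have : t < (gauge Omega p x + 1)^-1.
  by near: t; apply: nbhs_right_lt; rewrite invr_gt0; lra.
by rewrite -[X in _ < X]div1r ltr_pdivlMr; [nra|lra].
Unshelve. all: by end_near. Qed.

Lemma cvg_gauge_base (p x v : 'rV[R]_n) : Omega p ->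
  gauge Omega (p + t *: x) v @[t --> (0 : R)^'+] --> gauge Omega p v.
Proof.
move=> Op.
have id0 : t @[t --> (0 : R)^'+] --> (0 : R).
  by apply: cvg_at_right_filter; exact: cvg_id.
have lim0 (c : R) : gauge Omega p v / (1 + t * c) @[t --> (0 : R)^'+]
    --> gauge Omega p v.
  rewrite -[X in _ --> X]divr1; apply: cvgM; first exact: cvg_cst.
  apply: cvgV; first exact: oner_neq0.
  rewrite -[X in _ --> X]addr0 -[X in _ --> _ + X](mul0r c).
  by apply: cvgD; [exact: cvg_cst|apply: cvgM => //; exact: cvg_cst].
apply: squeeze_cvgr (lim0 (gauge Omega p (- x))) (lim0 (- gauge Omega p x)).
near=> t.
have t0 : 0 < t by near: t; exact: nbhs_right_gt.
have Otx : Omega (p + t *: x) by near: t; exact: near0_displacement.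
have x1 := (gauge_lt1 oO cO Op (t *: x)).2 Otx.
have := gauge_shift_le oO cO v Op Otx; have := gauge_shift_ge oO cO v Op Otx.
have := gauge_ge0 (- x) : 0 <= gauge Omega p (- x).
rewrite -scalerN !gaugeZ ?(ltW t0) // in x1 *.
move=> n0 lo hi; have tn0 := mulr_ge0 (ltW t0) n0.
apply/andP; split.
  by rewrite ler_pdivrMr 1?mulrC //; lra.
rewrite mulrN ler_pdivlMr; last by lra.
by rewrite mulrC; lra.
Unshelve. all: by end_near. Qed.

End Funk.

(** First order expansion of the logarithm at 1, along a convergent slope: if
    [0 < t] and [t * u < 1], then
    [u <= - ln (1 - t * u) / t <= u / (1 - t * u)]. *)
Lemma cvg_ln_slope (R : realType) (f : R -> R) (l : R) :
  f t @[t --> (0 : R)^'+] --> l ->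
  - ln (1 - t * f t) / t @[t --> (0 : R)^'+] --> l.
Proof.
move=> fl.
have tf0 : 1 - t * f t @[t --> (0 : R)^'+] --> (1 : R).
  rewrite -[X in _ --> X]subr0 -[X in _ --> _ - X](mul0r l).
  apply: cvgB; first exact: cvg_cst.
  by apply: cvgM => //; apply: cvg_at_right_filter; exact: cvg_id.
have up : f t / (1 - t * f t) @[t --> (0 : R)^'+] --> l.
  rewrite -[X in _ --> X]divr1; apply: cvgM => //.
  by apply: cvgV tf0; exact: oner_neq0.
apply: squeeze_cvgr fl up; near=> t.
have t0 : 0 < t by near: t; exact: nbhs_right_gt.
have p0 : 0 < 1 - t * f t.
  by near: t; apply: (cvgr_gt _ tf0); exact: ltr01.
apply/andP; split.
  rewrite ler_pdivlMr // mulrC lerNr.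
  by apply: le_ln1Dx; lra.
rewrite ler_pdivrMr // -lnV ?posrE //.
have -> : f t / (1 - t * f t) * t = (1 - t * f t)^-1 - 1.
  by field; rewrite gt_eqF.
rewrite -[X in ln X](subrKC 1); apply: le_ln1Dx.
by rewrite ltrBrDl subrr invr_gt0.
Unshelve. all: by end_near. Qed.

Lemma cvg_funk_quotient (R : realType) (n : nat) (Omega : set 'rV[R]_n)
    (p x y : 'rV[R]_n) : open Omega -> convex_set Omega -> Omega p ->
  funk_quotient Omega p x y t @[t --> (0 : R)^'+] --> gauge Omega p (y - x).
Proof.
move=> oO cO Op.
have slope := cvg_ln_slope (cvg_gauge_base oO cO x (v := y - x) Op).
apply: cvg_trans slope; apply: near_eq_cvg; near=> t.
have t0 : 0 < t by near: t; exact: nbhs_right_gt.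
rewrite /funk_quotient funk_gauge //; last 2 first.
- by near: t; exact: near0_displacement.
- by near: t; exact: near0_displacement.
have Otx : Omega (p + t *: x) by near: t; exact: near0_displacement.
rewrite opprD addrACA subrr add0r -scalerBr gaugeZ //; exact: ltW.
Unshelve. all: by end_near. Qed.

Theorem theorem9p1 (R : realType) (n : nat) (Omega : set 'rV[R]_n)
    (p : 'rV[R]_n) (HOmega : proper_convex_domain Omega) (Hp : Omega p) :
  [/\ forall x y : 'rV[R]_n,
        (\forall t \near (0 : R)^'+,
           Omega (p + t *: x) /\ Omega (p + t *: y)) /\
        cvg (funk_quotient Omega p x y t @[t --> (0 : R)^'+]),
      minkowski_weak_metric (Phi Omega p)
    & unit_ball (Phi Omega p) = [set y - p | y in Omega]].
Proof.
have [_ oO cO _] := HOmega.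
have PhiE x y : Phi Omega p x y = gauge Omega p (y - x).
  by apply: cvg_lim => //; exact: cvg_funk_quotient.
split.
- move=> x y; split.
    by apply: filterI; exact: near0_displacement.
  by apply/cvg_ex; exists (gauge Omega p (y - x)); exact: cvg_funk_quotient.
- exists (gauge Omega p) => //; split=> [v|l v l0|v w].
  + exact: gauge_ge0.
  + exact: gaugeZ.
  + exact: gaugeD.
- rewrite /unit_ball; apply/seteqP; split=> y /=; rewrite PhiE subr0.
    by move=> /(gauge_lt1 oO cO Hp) Oy; exists (p + y); rewrite // addrC addKr.
  by case=> z Oz <-; apply/gauge_lt1 => //; rewrite addrC subrK.
Qed.
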